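(* Let $R$ be a $2$-$\sqrt{J}U$ ring and let $e\in R$ be a nonzero idempotent. Then the corner ring $eRe$ (with identity $e$) is a $2$-$\sqrt{J}U$ ring.
   Context: All rings are associative with identity $1\neq 0$. For a ring $R$, $J(R)$ denotes the Jacobson radical, $U(R)$ the group of units, and $\sqrt{J(R)}=\{x\in R : x^m\in J(R)\text{ for some } m\ge 1\}$. A ring $R$ is a $2$-$\sqrt{J}U$ ring if $u^2\in 1+\sqrt{J(R)}$ for every $u\in U(R)$. *)

(* Defs.v *)
From HB Require Import structures.
From mathcomp Require Import all_boot all_algebra.
From mathcomp Require Import boolp classical_sets.

Set Implicit Arguments.
Unset Strict Implicit.
Unset Printing Implicit Defensive.

Import GRing.Theory.

Local Open Scope classical_set_scope.
Local Open Scope ring_scope.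

Section Radical.
Variable R : nzRingType.

Definition left_ideal (I : set R) : Prop :=
  [/\ I 0, (forall x y, I x -> I y -> I (x + y))
    & (forall a x, I x -> I (a * x))].

Definition maximal_left_ideal (I : set R) : Prop :=
  [/\ left_ideal I, I <> setT
    & forall K : set R, left_ideal K -> I `<=` K -> K <> setT -> K = I].

Definition jacobson : set R :=
  \bigcap_(I in [set I | maximal_left_ideal I]) I.

Definition sqrt_jacobson : set R :=
  [set x | exists m : nat, (1 <= m)%N /\ jacobson (x ^+ m)].

(* A [nzRingType] carries no inversion operation, so [GRing.unit] is not
   available on it; in a noncommutative ring a unit is two-sided. *)
Definition units : set R :=
  [set u | exists v : R, v * u = 1 /\ u * v = 1].

Definition two_sqrtJU : Prop :=
  forall u : R, units u -> [set 1 + x | x in sqrt_jacobson] (u ^+ 2).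

End Radical.

Arguments jacobson R : clear implicits.
Arguments sqrt_jacobson R : clear implicits.
Arguments units R : clear implicits.
Arguments two_sqrtJU R : clear implicits.

Definition corner_set (R : nzRingType) (e : R) : set R :=
  [set e * r * e | r in [set: R]].

(* The proofs [ee] and [e0] are parameters of the type so that its ring
   structure, which needs them, can be inferred. *)
Record corner (R : nzRingType) (e : R) (ee : e * e = e) (e0 : e != 0) :=
  Corner { corner_val : R; corner_valP : corner_val \in corner_set e }.

Section CornerRing.
Variables (R : nzRingType) (e : R) (ee : e * e = e) (e0 : e != 0).

Local Notation eRe := (corner ee e0).
Local Notation val := (@corner_val R e ee e0).

HB.instance Definition _ := [isSub for val].
HB.instance Definition _ := [Choice of eRe by <:].

Lemma corner_setP (x : R) : x \in corner_set e <-> e * x = x /\ x * e = x.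
Proof using ee.
split=> [/set_mem[r _ <-]|[ex xe]]; last first.
  by apply/mem_set; exists x => //; rewrite ex xe.
by split; [rewrite !mulrA ee | rewrite -mulrA ee].
Qed.

Fact corner_zmod_closed : zmod_closed (fun x : R => x \in corner_set e).
Proof using ee.
split=> [|x y]; first by apply/corner_setP; rewrite mulr0 mul0r.
move=> /corner_setP[ex xe] /corner_setP[ey ye].
by apply/corner_setP; rewrite mulrBr mulrBl ex xe ey ye.
Qed.

HB.instance Definition _ :=
  GRing.SubChoice_isSubZmodule.Build R _ eRe corner_zmod_closed.

Lemma corner_val_inj : injective val.
Proof using Type. exact: val_inj. Qed.

Lemma corner_val0 : val 0 = 0.
Proof using Type. exact: (raddf0 (\val : {additive eRe -> R})). Qed.

Lemma corner_valD : {morph val : x y / x + y}.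
Proof using Type. exact: (raddfD (\val : {additive eRe -> R})). Qed.

Lemma corner_valN : {morph val : x / - x}.
Proof using Type. exact: (raddfN (\val : {additive eRe -> R})). Qed.

Fact corner_one_subproof : e \in corner_set e.
Proof using ee. by apply/corner_setP; rewrite ee. Qed.

Fact corner_mul_subproof (x y : eRe) : val x * val y \in corner_set e.
Proof using ee.
have [/corner_setP[ex _] /corner_setP[_ ye]] := (corner_valP x, corner_valP y).
by apply/corner_setP; rewrite mulrA ex -mulrA ye.
Qed.

Definition corner_one : eRe := Corner ee e0 corner_one_subproof.
Definition corner_mul (x y : eRe) : eRe :=
  Corner ee e0 (corner_mul_subproof x y).

Fact corner_mulE (x y : eRe) : val (corner_mul x y) = val x * val y.
Proof using Type. by []. Qed.

Fact corner_mulA : associative corner_mul.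
Proof using Type. by move=> x y z; apply/corner_val_inj/mulrA. Qed.

Fact corner_mul1 : left_id corner_one corner_mul.
Proof using Type.
move=> x; apply: corner_val_inj.
by have [] := (corner_setP _).1 (corner_valP x).
Qed.

Fact corner_mulr1 : right_id corner_one corner_mul.
Proof using Type.
move=> x; apply: corner_val_inj.
by have [] := (corner_setP _).1 (corner_valP x).
Qed.

Fact corner_mulDl : left_distributive corner_mul +%R.
Proof using Type.
move=> x y z; apply: corner_val_inj.
by rewrite corner_valD !corner_mulE corner_valD mulrDl.
Qed.

Fact corner_mulDr : right_distributive corner_mul +%R.
Proof using Type.
move=> x y z; apply: corner_val_inj.
by rewrite corner_valD !corner_mulE corner_valD mulrDr.
Qed.

Fact corner_oner_neq0 : corner_one != 0.
Proof using Type.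
by apply: contra_neq e0 => /(congr1 val); rewrite corner_val0.
Qed.

HB.instance Definition _ := GRing.Zmodule_isNzRing.Build eRe
  corner_mulA corner_mul1 corner_mulr1 corner_mulDl corner_mulDr
  corner_oner_neq0.

Lemma corner_val1 : val 1 = e.
Proof using Type. by []. Qed.

Lemma corner_valM : {morph val : x y / x * y}.
Proof using Type. by []. Qed.

End CornerRing.

(* Main.v *)
Require Import Defs.
From mathcomp Require Import all_boot all_algebra.
From mathcomp Require Import boolp classical_sets.

(** A unit [u] of [eRe] extends to the unit [u + (1 - e)] of [R], whose square
is [u ^+ 2 + (1 - e)].  The hypothesis on [R] therefore says that
[x = u ^+ 2 - e], an element of [eRe], has a power [x ^+ m] with [1 <= m] in
[J(R)].  It remains to see that [eRe] meets [J(R)] inside [J(eRe)]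
([jacobson_corner]).

For this, a maximal left ideal [M] of [eRe] is induced up to
[N = { x | e R x e is contained in M }], which is a maximal left ideal of [R]
([maximal_corner_induced]): [R / N] is the simple [R]-module whose [e]-part is
[eRe / M].  An element [y] of [eRe] lying in [J(R)] lies in [N], hence
[y = e y e] lies in [M].  Inducing ideals explicitly in this way dispenses with
the quasi-regular description of the radical, and so with Zorn's lemma. *)

Import GRing.Theory.

Local Open Scope classical_set_scope.
Local Open Scope ring_scope.

Lemma left_ideal_oneT {R : nzRingType} {I : set R} :
  left_ideal I -> I 1 -> I = setT.
Proof.
by move=> [_ _ IM] I1; apply/seteqP; split=> // x _; rewrite -(mulr1 x); apply: IM.
Qed.

Lemma maximal_left_ideal_comax {R : nzRingType} {I : set R} {x : R} :
  maximal_left_ideal I -> ~ I x ->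
  exists i a : R, I i /\ 1 = i + a * x.
Proof.
move=> [[I0 ID IM] _ Imax] nIx.
pose K : set R := [set y | exists i a : R, I i /\ y = i + a * x].
have Kid : left_ideal K.
  split.
  - by exists 0, 0; rewrite mul0r addr0.
  - move=> _ _ [i [a [Ii ->]]] [j [b [Ij ->]]].
    by exists (i + j), (a + b); split; [apply: ID | rewrite mulrDl addrACA].
  - move=> c _ [i [a [Ii ->]]].
    by exists (c * i), (c * a); split; [apply: IM | rewrite mulrDr mulrA].
have IK : I `<=` K by move=> i Ii; exists i, 0; rewrite mul0r addr0.
have Kx : K x by exists 0, 1; rewrite mul1r add0r.
have KT : K = setT.
  by apply: contrapT => KnT; apply: nIx; rewrite -(Imax K Kid IK KnT).
by have : K 1 by rewrite KT.
Qed.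

Section Corner.
Variables (R : nzRingType) (e : R) (ee : e * e = e) (e0 : e != 0).

Local Notation eRe := (corner ee e0).
Local Notation val := (@corner_val R e ee e0).

Fact corner_proj_subproof (r : R) : e * r * e \in corner_set e.
Proof. by apply/mem_set; exists r. Qed.

(** The Peirce projection of [R] onto [eRe], sending [r] to [e r e]. *)
Definition corner_proj (r : R) : eRe := Corner ee e0 (corner_proj_subproof r).

Lemma corner_mull (a : eRe) : e * val a = val a.
Proof. by have [] := (corner_setP ee _).1 (corner_valP a). Qed.

Lemma corner_mulr (a : eRe) : val a * e = val a.
Proof. by have [] := (corner_setP ee _).1 (corner_valP a). Qed.

Lemma corner_projD (x y : R) :
  corner_proj (x + y) = corner_proj x + corner_proj y.
Proof. by apply: corner_val_inj; rewrite corner_valD /= mulrDr mulrDl. Qed.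

Lemma corner_projK (a : eRe) : corner_proj (val a) = a.
Proof. by apply: corner_val_inj; rewrite /= corner_mull corner_mulr. Qed.

Lemma corner_projMr (r : R) (a : eRe) :
  corner_proj (r * val a) = corner_proj r * a.
Proof.
by apply: corner_val_inj; rewrite corner_valM /= -!mulrA corner_mulr corner_mull.
Qed.

Lemma corner_proj_compl (r : R) : corner_proj (r * (1 - e)) = 0.
Proof.
apply: corner_val_inj; rewrite corner_val0 /=.
by rewrite -!mulrA mulrBl mul1r ee subrr !mulr0.
Qed.

(** The left ideal of [R] induced by a left ideal [M] of [eRe]: all [x] such
that [e R x e] is contained in [M]. *)
Definition corner_induced (M : set eRe) : set R :=
  [set x | forall r : R, M (corner_proj (r * x))].

Lemma left_ideal_corner_induced (M : set eRe) :
  left_ideal M -> left_ideal (corner_induced M).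
Proof.
move=> [M0 MD MM]; split.
- by move=> r; rewrite -(corner_val0 ee e0) corner_projMr mulr0.
- by move=> x y Nx Ny r; rewrite mulrDr corner_projD; apply: MD.
- by move=> a x Nx r; rewrite mulrA.
Qed.

Lemma sub_corner_induced (M : set eRe) (a : eRe) :
  left_ideal M -> M a -> corner_induced M (val a).
Proof. by move=> [_ _ MM] Ma r; rewrite corner_projMr; apply: MM. Qed.

Lemma corner_induced_sub (M : set eRe) (a : eRe) :
  corner_induced M (val a) -> M a.
Proof. by move=> /(_ 1); rewrite mul1r corner_projK. Qed.

(** If [x] is not in the induced ideal, some [e r x e] is not in [M], so the
identity of [eRe] is [m + s e r x e] with [m] in [M] and [s] in [eRe]; this puts
[e] in every left ideal containing [x] and the induced ideal. *)
Lemma maximal_corner_induced (M : set eRe) :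
  maximal_left_ideal M -> maximal_left_ideal (corner_induced M).
Proof.
move=> Mmax; have [Mid MnT _] := Mmax; split.
- exact: left_ideal_corner_induced.
- move=> NT; apply: MnT; apply: left_ideal_oneT => //.
  by apply: corner_induced_sub; rewrite NT.
- move=> K Kid NK KnT; have [_ KD KM] := Kid.
  apply/seteqP; split=> // x Kx r; apply: contrapT => nMrx; apply: KnT.
  have [m [s [Mm one_eq]]] := maximal_left_ideal_comax Mmax nMrx.
  (* [1 - e] lies in the induced ideal, so [K] is stable under right
     multiplication by [e] and it suffices to put [e] in [K]. *)
  have KC : K (1 - e).
    by apply: NK => t; rewrite corner_proj_compl; have [] := Mid.
  have Kxe : K (x * e).
    rewrite (_ : x * e = x + - x * (1 - e)); first by apply: KD => //; apply: KM.
    by rewrite mulrBr mulr1 !mulNr opprK addNKr.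
  have Ke : K e.
    rewrite -(corner_val1 ee e0) one_eq corner_valD corner_valM /=.
    apply: KD; first by apply: NK; apply: sub_corner_induced.
    by rewrite -!mulrA; do 3!apply: (KM).
  by apply: left_ideal_oneT => //; rewrite -(subrK e 1); apply: KD.
Qed.

Lemma jacobson_corner (a : eRe) : jacobson R (val a) -> jacobson eRe a.
Proof.
move=> Ja M Mmax; apply: corner_induced_sub.
by apply: Ja; apply: maximal_corner_induced.
Qed.

(** The exponent [0] is excluded: [val 1] is [e], not [1]. *)
Lemma corner_valXS (a : eRe) (m : nat) : val (a ^+ m.+1) = val a ^+ m.+1.
Proof. by elim: m => // m IHm; rewrite exprS corner_valM IHm -exprS. Qed.

Lemma sqrt_jacobson_corner (a : eRe) :
  sqrt_jacobson R (val a) -> sqrt_jacobson eRe a.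
Proof.
move=> [[|m] [// _ Jam]]; exists m.+1; split=> //.
by apply: jacobson_corner; rewrite corner_valXS.
Qed.

Lemma mul_corner_compl (a b : eRe) :
  (val a + (1 - e)) * (val b + (1 - e)) = val (a * b) + (1 - e).
Proof.
rewrite mulrDl [val a * _]mulrDr [(1 - e) * _]mulrDr corner_valM.
rewrite [val a * (1 - e)]mulrBr [(1 - e) * val b]mulrBl.
rewrite [(1 - e) * (1 - e)]mulrBr [(1 - e) * e]mulrBl.
by rewrite !mulr1 !mul1r corner_mulr corner_mull ee !subrr addr0 add0r subr0.
Qed.

Lemma units_corner_compl {u : eRe} : units eRe u -> units R (val u + (1 - e)).
Proof.
move=> [v [vu uv]]; exists (val v + (1 - e)).
by rewrite !mul_corner_compl vu uv corner_val1 addrC subrK.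
Qed.

End Corner.

Theorem theorem2p7 (R : nzRingType) (hR : two_sqrtJU R) (e : R)
    (ee : e * e = e) (e0 : e != 0) :
  two_sqrtJU (corner ee e0).
Proof.
move=> u uU; have [x Jx x_eq] := hR _ (units_corner_compl _ _ _ _ uU).
rewrite expr2 mul_corner_compl in x_eq.
exists (u ^+ 2 - 1); last by rewrite addrC subrK.
apply: sqrt_jacobson_corner.
suff -> : corner_val (u ^+ 2 - 1) = x by [].
rewrite expr2 corner_valD corner_valN (corner_val1 ee e0).
by apply: (addrI 1); rewrite x_eq addrCA.
Qed.
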